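(* Let $\mathcal{D} = (V,E)$ be a directed acyclic graph with $V = \{1,\ldots,n\}$, let $k$ be a positive integer, let $\mathcal{G} = \mathcal{G}(\mathcal{D},k)$ be the state space of the $k$-state discrete max-linear Bayesian network (D-MLBN) model on $\mathcal{D}$, and let $\psi_{\mathcal{D}}^{(k)}$ be the map parameterizing this model. Homogenize $\psi_{\mathcal{D}}^{(k)}$ with a new parameter $t$, i.e. replace it by $(t,\theta) \mapsto (t\,\psi_g(\theta))_{g \in \mathcal{G}}$ with $t \in \mathbb{R}$, and let $I_{\mathcal{D}}^{(k)} \subseteq \mathbb{R}[p_g : g \in \mathcal{G}]$ be the ideal of all polynomials vanishing on the image of this homogenized map. Apply the linear change of coordinates \[ q_g = \sum_{h \in \mathcal{G},\; h \leq g} p_h , \qquad g \in \mathcal{G}, \] on $\mathbb{R}[p_g : g \in \mathcal{G}]$. Then, in the coordinates $q_g$, the ideal $I_{\mathcal{D}}^{(k)}$ is equal to the toric ideal associated to the distributive lattice $J(\mathcal{D}^{\mathrm{tr}} \times \mathbf{k-1})$ (with $\mathcal{G}$ identified with the elements of this lattice by the bijection $g \mapsto \tilde g$ defined in the context), with generating set \[ I_{\mathcal{D}}^{(k)} = \langle q_g q_h - q_{g \wedge h}\, q_{g \vee h} : g, h \in \mathcal{G} \text{ are incomparable} \rangle . \]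
   Context: For a DAG $\mathcal{D}$ on $V=\{1,\ldots,n\}$, $\mathrm{pa}(i)$ (parents of $i$) is the set of $j$ with an edge $j \to i$ in $E$. The transitive closure poset $\mathcal{D}^{\mathrm{tr}}$ is the poset on $V$ with $j \leq i$ if and only if $j = i$ or there is a directed path from $j$ to $i$ in $\mathcal{D}$. $k$-state D-MLBN model on $\mathcal{D}$: let $Z_i$, $i \in V$, be independent random variables with states $\{0,\ldots,k-1\}$, with $Z_i$ having distribution $\theta^{(i)} = (\theta_0^{(i)}, \ldots, \theta_{k-1}^{(i)})$ in the probability simplex $\Delta_{k-1}$ (nonnegative entries summing to $1$); the model is the family of joint distributions of $(X_i)_{i\in V}$ defined by $X_i = \bigvee_{j \in \mathrm{pa}(i)} X_j \vee Z_i$, where $\vee$ denotes maximum. The state space $\mathcal{G}(\mathcal{D},k)$ is the set of $g = (g_1,\ldots,g_n) \in \{0,\ldots,k-1\}^n$ such that $i \mapsto g_i$ is an order-preserving map $\mathcal{D}^{\mathrm{tr}} \to \{0 < 1 < \cdots < k-1\}$. It is partially ordered coordinate-wise and is a distributive lattice with meet $g \wedge h$ the coordinate-wise minimum and join $g \vee h$ the coordinate-wise maximum. Elements $g,h$ are incomparable if neither $g \leq h$ nor $h \leq g$. The parameterization is $\psi_{\mathcal{D}}^{(k)} : (\Delta_{k-1})^n \to \mathbb{R}^{\mathcal{G}}$, $\theta \mapsto (\psi_g(\theta))_{g\in\mathcal{G}}$, with $\psi_g(\theta) = P(X = g) = \prod_{i \in V} P(X_i = g_i \mid X_{\mathrm{pa}(i)}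 = g_{\mathrm{pa}(i)})$, where, with $M_i = \bigvee_{j \in \mathrm{pa}(i)} g_j$ (and $M_i = 0$ if $\mathrm{pa}(i) = \emptyset$), the conditional probability $P(X_i = g_i \mid X_{\mathrm{pa}(i)} = g_{\mathrm{pa}(i)})$ equals $0$ if $g_i < M_i$, equals $\sum_{\ell \leq M_i} \theta_\ell^{(i)}$ if $g_i = M_i$, and equals $\theta_{g_i}^{(i)}$ if $g_i > M_i$. For a finite poset $P$, $J(P)$ denotes the distributive lattice of order ideals (down-closed subsets) of $P$ ordered by inclusion. The toric (Hibi) ideal associated to the distributive lattice $L = J(P)$ is the kernel $I_L$ of the ring homomorphism $\varphi_L : \mathbb{R}[q_I : I \in L] \to \mathbb{R}[t, x_a : a \in P]$, $q_I \mapsto t \prod_{a \in I} x_a$. $\mathbf{k-1}$ denotes the chain with $k-1$ elements, here written $\{0 < 1 < \cdots < k-2\}$ (empty if $k=1$), and $\mathcal{D}^{\mathrm{tr}} \times \mathbf{k-1}$ has the product order. The elements of $\mathcal{G}(\mathcal{D},k)$ are identified with those of $J(\mathcal{D}^{\mathrm{tr}} \times \mathbf{k-1})$ by the bijection $g \mapsto \tilde g = \{(i,r) : i \in V,\ 0 \leq r \leq k - g_i - 2\}$, and correspondingly the variable $q_g$ is identified with $q_{\tilde g}$. *)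

(* Defs.v *)
From HB Require Import structures.
From mathcomp Require Import all_boot all_order all_algebra.
From mathcomp Require Import reals zify.
From mathcomp Require Import mpoly.
Set Implicit Arguments.
Unset Strict Implicit.
Unset Printing Implicit Defensive.
Import Order.TTheory GRing.Theory Num.Theory.
Local Open Scope ring_scope.

(* Polynomial rings with variables indexed by a finite type [T]; the
   enumeration of [T] turns them into instances of [{mpoly R[_]}]. *)
Notation polyring R T := {mpoly R[#|{: T}|]}.

Definition var (R : comNzRingType) (T : finType) (x : T) : polyring R T :=
  'X_(enum_rank x).

Definition peval (R : comNzRingType) (T : finType) (v : T -> R)
    (f : polyring R T) : R :=
  f.@[fun i => v (enum_val i)].

Definition psubst (R : comNzRingType) (T U : finType)
    (s : T -> polyring R U) (f : polyring R T) : polyring R U :=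
  f \mPo [tuple s (enum_val i) | i < #|{: T}|].

Lemma psubst_var (R : comNzRingType) (T U : finType)
    (s : T -> polyring R U) (x : T) : psubst s (var R x) = s x.
Proof. by rewrite /psubst comp_mpolyXU -tnth_nth tnth_mktuple enum_rankK. Qed.

Lemma psubst_sum (R : comNzRingType) (T U : finType) (s : T -> polyring R U)
    (I : finType) (Q : pred I) (F : I -> polyring R T) :
  psubst s (\sum_(i | Q i) F i) = \sum_(i | Q i) psubst s (F i).
Proof. exact: raddf_sum. Qed.

Lemma psubstB (R : comNzRingType) (T U : finType) (s : T -> polyring R U) :
  {morph psubst s : f g / f - g}.
Proof. exact: raddfB. Qed.

Lemma psubstK (R : comNzRingType) (T U : finType)
    (s : T -> polyring R U) (s' : U -> polyring R T) :
  (forall x, psubst s' (s x) = var R x) -> cancel (psubst s) (psubst s').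
Proof.
move=> ss' f; rewrite /psubst (comp_mpolyEX f) raddf_sum /=.
rewrite [RHS]mpolyE; apply: eq_bigr => m _.
rewrite comp_mpolyZ comp_mpolyX rmorph_prod /= mpolyXE_id; congr (_ *: _).
apply: eq_bigr => i _; rewrite rmorphXn /= tnth_mktuple.
by have := ss' (enum_val i); rewrite /psubst /var enum_valK => ->.
Qed.

Section CumulativeCoordinates.
Variables (R : comNzRingType) (d : Order.disp_t) (T : finPOrderType d).

Definition cumulative (g : T) : polyring R T :=
  \sum_(h : T | (h <= g)%O) var R h.

Fixpoint mobius_rec (m : nat) (g : T) : polyring R T :=
  if m is m'.+1 then var R g - \sum_(h : T | (h < g)%O) mobius_rec m' h else 0.

Definition mobius (g : T) : polyring R T := mobius_rec #|T| g.

Let rank (g : T) : nat := #|[set h : T | (h < g)%O]|.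

Let rank_lt (h g : T) : (h < g)%O -> (rank h < rank g)%N.
Proof.
move=> hg; apply/proper_card/properP; split.
  by apply/subsetP => x; rewrite !inE => /lt_trans; apply.
by exists h; rewrite !inE ?ltxx.
Qed.

Let rank_max (g : T) : (rank g < #|T|)%N.
Proof.
rewrite -cardsT; apply/proper_card/properP; split; first exact: subsetT.
by exists g; rewrite !inE ?ltxx.
Qed.

Lemma mobius_stable m m' (g : T) :
  (rank g < m)%N -> (rank g < m')%N -> mobius_rec m g = mobius_rec m' g.
Proof.
elim: m m' g => [//|m IH] [//|m'] g gm gm' /=; congr (_ - _).
apply: eq_bigr => h hg; apply: IH; exact: leq_trans (rank_lt hg) _.
Qed.

Lemma sum_le_lt (F : T -> polyring R T) (g : T) :
  \sum_(h : T | (h <= g)%O) F h = F g + \sum_(h : T | (h < g)%O) F h.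
Proof.
rewrite (bigD1 g) //=; congr (_ + _); apply: eq_bigl => h.
by rewrite lt_neqAle andbC.
Qed.

Lemma mobiusE (g : T) :
  mobius g = var R g - \sum_(h : T | (h < g)%O) mobius h.
Proof.
rewrite /mobius; have gT := rank_max g.
rewrite (@mobius_stable _ #|T|.+1 g gT (ltnW gT)) /=; congr (_ - _).
Qed.

Lemma cumulativeK : cancel (psubst cumulative) (psubst mobius).
Proof.
apply: psubstK => g; rewrite psubst_sum.
under eq_bigr do rewrite psubst_var.
by rewrite sum_le_lt mobiusE subrK.
Qed.

Lemma mobiusK : cancel (psubst mobius) (psubst cumulative).
Proof.
apply: psubstK => g; have [m] := ubnP (rank g).
elim: m g => [//|m IH] g gm; rewrite mobiusE psubstB psubst_sum psubst_var.
rewrite (eq_bigr (fun h => var R h)); last first.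
  by move=> h hg; apply: IH; apply: leq_trans (rank_lt hg) _.
by rewrite /cumulative sum_le_lt addrK.
Qed.

Lemma cumulative_bij : bijective (psubst cumulative).
Proof. exact: Bijective cumulativeK mobiusK. Qed.

End CumulativeCoordinates.

Definition ideal_gen (A : comNzRingType) (S : A -> Prop) (f : A) : Prop :=
  exists (m : nat) (c s : 'I_m -> A),
    (forall i, S (s i)) /\ f = \sum_(i < m) c i * s i.

Fact ideal_display : Order.disp_t. Proof. exact: Order.Disp tt tt. Qed.

Section OrderIdeals.
Variables (d : Order.disp_t) (P : finPOrderType d).

Definition down_closed (I : {set P}) : bool :=
  [forall a in I, forall b, (b <= a)%O ==> (b \in I)].

Definition order_ideals : Type := {I : {set P} | down_closed I}.

HB.instance Definition _ := Finite.on order_ideals.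

Lemma down_closedP (I : {set P}) :
  reflect (forall a b, a \in I -> (b <= a)%O -> b \in I) (down_closed I).
Proof.
apply: (iffP forall_inP) => [H a b aI ba|H a aI].
  by move: (H a aI) => /forallP/(_ b)/implyP; apply.
by apply/forallP => b; apply/implyP; apply: H.
Qed.

Lemma down_closedI (I J : order_ideals) : down_closed (val I :&: val J).
Proof.
case: I J => [I /= /down_closedP hI] [J /= /down_closedP hJ].
apply/down_closedP => a b; rewrite !inE => /andP[aI aJ] ba.
by rewrite (hI a b aI ba) (hJ a b aJ ba).
Qed.

Lemma down_closedU (I J : order_ideals) : down_closed (val I :|: val J).
Proof.
case: I J => [I /= /down_closedP hI] [J /= /down_closedP hJ].
apply/down_closedP => a b; rewrite !inE => /orP[aI|aJ] ba.
  by rewrite (hI a b aI ba).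
by rewrite (hJ a b aJ ba) orbT.
Qed.

Definition ideal_le (I J : order_ideals) : bool := val I \subset val J.
Definition ideal_meet (I J : order_ideals) : order_ideals :=
  exist (fun X => is_true (down_closed X)) _ (down_closedI I J).
Definition ideal_join (I J : order_ideals) : order_ideals :=
  exist (fun X => is_true (down_closed X)) _ (down_closedU I J).

Fact ideal_le_def I J : ideal_le I J = (ideal_meet I J == I).
Proof. by rewrite -val_eqE /=; apply/setIidPl/eqP. Qed.
Fact ideal_meetC : commutative ideal_meet.
Proof. by move=> I J; apply: val_inj; apply: setIC. Qed.
Fact ideal_joinC : commutative ideal_join.
Proof. by move=> I J; apply: val_inj; apply: setUC. Qed.
Fact ideal_meetA : associative ideal_meet.
Proof. by move=> I J K; apply: val_inj; apply: setIA. Qed.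
Fact ideal_joinA : associative ideal_join.
Proof. by move=> I J K; apply: val_inj; apply: setUA. Qed.
Fact ideal_joinKI J I : ideal_meet I (ideal_join I J) = I.
Proof. by apply: val_inj; rewrite /= setIC setUK. Qed.
Fact ideal_meetKU J I : ideal_join I (ideal_meet I J) = I.
Proof. by apply: val_inj; rewrite /= setUC setIK. Qed.
Fact ideal_meetUl : left_distributive ideal_meet ideal_join.
Proof. by move=> I J K; apply: val_inj; apply: setIUl. Qed.
Fact ideal_meetxx : idempotent_op ideal_meet.
Proof. by move=> I; apply: val_inj; apply: setIid. Qed.

HB.instance Definition _ :=
  Order.isMeetJoinDistrLattice.Build ideal_display order_ideals
    ideal_le_def (fun _ _ => erefl) ideal_meetC ideal_joinC ideal_meetA
    ideal_joinA ideal_joinKI ideal_meetKU ideal_meetUl ideal_meetxx.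

(* In the codomain, [var None] is [t] and [var (Some a)] is [x_a]. *)
Definition hibi_map (R : comNzRingType) :
    polyring R order_ideals -> polyring R (option P) :=
  psubst (fun I : order_ideals =>
    var R (None : option P) * \prod_(a in val I) var R (Some a)).

Definition hibi_ideal (R : comNzRingType) (F : polyring R order_ideals) : Prop :=
  hibi_map F = 0.

End OrderIdeals.

Record dag (n : nat) := Dag {
  edge : rel 'I_n;
  edge_acyclic : forall c : seq 'I_n, cycle edge c -> c = [::]
}.

Fact tr_display : Order.disp_t. Proof. exact: Order.Disp tt tt. Qed.

Definition tr (n : nat) (D : dag n) : Type := 'I_n.

Section TransitiveClosure.
Variables (n : nat) (D : dag n).

HB.instance Definition _ := Finite.on (tr D).

Definition tr_le : rel (tr D) := connect (edge D).

Fact tr_le_refl : reflexive tr_le.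
Proof. exact: connect0. Qed.

Fact tr_le_trans : transitive tr_le.
Proof. exact: connect_trans. Qed.

Fact tr_le_anti : antisymmetric tr_le.
Proof.
move=> x y /andP[/connectP[p ep ->] /connectP[q eq qx]].
case/lastP: p => [//|p z] in ep eq qx *; rewrite last_rcons in eq qx *.
case/lastP: q => [|q w] in eq qx *; first by [].
rewrite last_rcons in qx; rewrite -qx in eq.
have := @edge_acyclic n D (x :: rcons p z ++ q).
rewrite /= rcons_cat cat_path ep last_rcons eq.
by move=> /(_ isT).
Qed.

HB.instance Definition _ := Order.Le_isPOrder.Build tr_display (tr D)
  tr_le_refl tr_le_anti tr_le_trans.

Lemma tr_leE (j i : tr D) : (j <= i)%O = connect (edge D) j i.
Proof. by []. Qed.

End TransitiveClosure.

Fact state_display : Order.disp_t. Proof. exact: Order.Disp tt tt. Qed.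

Section StateSpace.
Variables (n : nat) (D : dag n) (k : nat).

Definition order_preserving (g : {ffun tr D -> 'I_k}) : bool :=
  [forall j, forall i, (j <= i)%O ==> (g j <= g i)%O].

Definition state : Type := {g : {ffun tr D -> 'I_k} | order_preserving g}.

HB.instance Definition _ := Finite.on state.

Definition state_fun (g : state) : tr D -> 'I_k := val g.
Coercion state_fun : state >-> Funclass.

Lemma stateP (g h : state) : (forall i, g i = h i) -> g = h.
Proof. by move=> gh; apply/val_inj/ffunP. Qed.

Lemma order_preservingP (g : {ffun tr D -> 'I_k}) :
  reflect {homo g : j i / (j <= i)%O} (order_preserving g).
Proof.
apply: (iffP forallP) => [H j i|H j].
  by move: (H j) => /forallP/(_ i)/implyP.
by apply/forallP => i; apply/implyP; apply: H.
Qed.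

Lemma state_homo (g : state) : {homo g : j i / (j <= i)%O}.
Proof. exact/order_preservingP/(valP g). Qed.

Lemma order_preserving_min (g h : state) :
  order_preserving [ffun i => Order.min (g i) (h i)].
Proof.
apply/order_preservingP => j i ji; rewrite !ffunE.
by rewrite le_min !ge_min !state_homo ?orbT.
Qed.

Lemma order_preserving_max (g h : state) :
  order_preserving [ffun i => Order.max (g i) (h i)].
Proof.
apply/order_preservingP => j i ji; rewrite !ffunE.
by rewrite ge_max !le_max !state_homo ?orbT.
Qed.

Definition state_le (g h : state) : bool := [forall i, (g i <= h i)%O].
Definition state_meet (g h : state) : state :=
  exist (fun f => is_true (order_preserving f)) _ (order_preserving_min g h).
Definition state_join (g h : state) : state :=
  exist (fun f => is_true (order_preserving f)) _ (order_preserving_max g h).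

Lemma state_meetE g h i : state_meet g h i = Order.min (g i) (h i).
Proof. by rewrite /state_fun /= ffunE. Qed.

Lemma state_joinE g h i : state_join g h i = Order.max (g i) (h i).
Proof. by rewrite /state_fun /= ffunE. Qed.

Fact state_le_def g h : state_le g h = (state_meet g h == g).
Proof.
apply/forallP/eqP => [gh|<- i].
  by apply: stateP => i; rewrite state_meetE; apply/min_idPl.
by rewrite state_meetE ge_min lexx orbT.
Qed.
Fact state_meetC : commutative state_meet.
Proof. by move=> g h; apply: stateP => i; rewrite !state_meetE minC. Qed.
Fact state_joinC : commutative state_join.
Proof. by move=> g h; apply: stateP => i; rewrite !state_joinE maxC. Qed.
Fact state_meetA : associative state_meet.
Proof. by move=> f g h; apply: stateP => i; rewrite !state_meetE minA. Qed.
Fact state_joinA : associative state_join.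
Proof. by move=> f g h; apply: stateP => i; rewrite !state_joinE maxA. Qed.
Fact state_joinKI h g : state_meet g (state_join g h) = g.
Proof. by apply: stateP => i; rewrite state_meetE state_joinE maxKx. Qed.
Fact state_meetKU h g : state_join g (state_meet g h) = g.
Proof. by apply: stateP => i; rewrite state_joinE state_meetE minKx. Qed.
Fact state_meetUl : left_distributive state_meet state_join.
Proof.
by move=> f g h; apply: stateP => i; rewrite !(state_meetE, state_joinE) min_maxl.
Qed.
Fact state_meetxx : idempotent_op state_meet.
Proof. by move=> g; apply: stateP => i; rewrite state_meetE minxx. Qed.

HB.instance Definition _ :=
  Order.isMeetJoinDistrLattice.Build state_display state
    state_le_def (fun _ _ => erefl) state_meetC state_joinC state_meetA
    state_joinA state_joinKI state_meetKU state_meetUl state_meetxx.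

Lemma state_leE (g h : state) : (g <= h)%O = [forall i, (g i <= h i)%N].
Proof. by []. Qed.

Section Parameterization.
Variable R : realType.

Definition simplex (p : 'I_k -> R) : Prop :=
  (forall l, 0 <= p l) /\ \sum_l p l = 1.

(* The empty maximum is 0. *)
Definition parents_max (g : state) (i : 'I_n) : nat :=
  (\max_(j < n | edge D j i) g j)%N.

(* P(X_i = g_i | X_pa(i) = g_pa(i)) *)
Definition cond_prob (theta : 'I_n -> 'I_k -> R) (g : state) (i : 'I_n) : R :=
  let M := parents_max g i in
  if (g i < M)%N then 0
  else if (g i == M :> nat) then \sum_(l < k | (l <= M)%N) theta i l
  else theta i (g i).

Definition psi (theta : 'I_n -> 'I_k -> R) (g : state) : R :=
  \prod_(i < n) cond_prob theta g i.

(* [psi theta g] is the probability that the independent noise variables Z_i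
   of distributions [theta i] satisfy g_i = max (max_(j in pa(i)) g_j) Z_i for
   all i, i.e. that the solution X of the structural equations is g. *)
Lemma psiE (theta : 'I_n -> 'I_k -> R) (g : state) :
  psi theta g =
    \sum_(z : {ffun 'I_n -> 'I_k} |
          [forall i, (g i : nat) == maxn (parents_max g i) (z i)])
      \prod_(i < n) theta i (z i).
Proof.
pose Q i l := (g i : nat) == maxn (parents_max g i) (l : 'I_k).
have condE i : cond_prob theta g i = \sum_(l | Q i l) theta i l.
  rewrite /cond_prob /Q; case: ltngtP => [lt|gt|eqM].
  - rewrite big1 // => l /eqP gl; move: lt.
    by rewrite gl ltnNge leq_maxl.
  - rewrite (big_pred1 (g i)) // => l; apply/eqP/eqP => [gl|->]; last by lia.
    by apply: val_inj => /=; lia.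
  - by apply: eq_bigl => l; apply/idP/eqP; lia.
rewrite /psi (eq_bigr _ (fun i _ => condE i)) bigA_distr_big_dep /=.
by apply: eq_bigl => z; apply/familyP/forallP.
Qed.

Definition model_ideal (f : polyring R state) : Prop :=
  forall (t : R) (theta : 'I_n -> 'I_k -> R),
    (forall i, simplex (theta i)) ->
    peval (fun g => t * psi theta g) f = 0.

(* Rewrites a polynomial in the q_g as a polynomial in the p_g; this is an
   isomorphism by [cumulative_bij]. *)
Definition q_to_p : polyring R state -> polyring R state :=
  psubst (@cumulative R _ state).

Definition model_ideal_q (F : polyring R state) : Prop := model_ideal (q_to_p F).

Definition binomial_relation (F : polyring R state) : Prop :=
  exists g h : state, (g >< h)%O /\
    F = var R g * var R h - var R (g `&` h)%O * var R (g `|` h)%O.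

End Parameterization.

Definition grid : Type := tr D *p 'I_k.-1.
HB.instance Definition _ := Order.FinPOrder.on grid.

(* [r + g i + 2 <= k] is [r <= k - g i - 2] without truncated subtraction. *)
Definition tilde_set (g : state) : {set grid} :=
  [set a : grid | (a.2 + g a.1 + 2 <= k)%N].

Lemma tilde_down_closed (g : state) : down_closed (tilde_set g).
Proof.
apply/down_closedP => -[i r] [j s]; rewrite !inE /= => rk /andP[/= ji sr].
apply: leq_trans rk; rewrite leq_add2r leq_add //.
exact: (state_homo g ji).
Qed.

Definition tilde (g : state) : order_ideals grid :=
  exist (fun X => is_true (down_closed X)) _ (tilde_down_closed g).

Lemma mem_tilde (g : state) (i : tr D) (r : 'I_k.-1) :
  (((i, r) : grid) \in val (tilde g)) = (r + g i + 2 <= k)%N.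
Proof. by rewrite inE. Qed.

Lemma tilde_bij : (0 < k)%N -> bijective tilde.
Proof.
move=> k_gt0.
have tilde_arith a b : (a + b + 2 <= k)%N = (a + b < k.-1)%N.
  by rewrite addn2 -[X in (_ <= X)%N](prednK k_gt0).
pose col (I : order_ideals grid) (i : tr D) :=
  [set r : 'I_k.-1 | ((i, r) : grid) \in val I].
have memE (I : order_ideals grid) i r :
  (((i, r) : grid) \in val I) = (r < #|col I i|)%N.
  have cardlt m : (m <= k.-1)%N -> #|[set s : 'I_k.-1 | (s < m)%N]| = m.
    move=> mk; rewrite -sum1dep_card -(big_ord_widen _ (fun=> 1%N)) //.
    by rewrite sum1_card card_ord.
  have /down_closedP Idown := valP I.
  apply/idP/idP => [Ir|]; last apply: contraTT => Ir.
    rewrite -[r.+1](cardlt _ (ltn_ord r)); apply: subset_leq_card; apply/subsetP => s.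
    rewrite !inE ltnS => sr; apply: Idown Ir _.
    by apply/andP; split=> //=; exact: lexx.
  rewrite -leqNgt -[X in (_ <= X)%N](cardlt _ (ltnW (ltn_ord r))).
  apply: subset_leq_card; apply/subsetP => s; rewrite !inE => Is.
  rewrite ltnNge; apply: contraNN Ir => rs; apply: Idown Is _.
  by apply/andP; split=> //=; exact: lexx.
have col_le I i : (#|col I i| <= k.-1)%N.
  by rewrite -[k.-1 in X in (_ <= X)%N]card_ord max_card.
have gP I i : (k.-1 - #|col I i| < k)%N.
  by rewrite (leq_ltn_trans (leq_subr _ _)) // prednK.
pose gf I : {ffun tr D -> 'I_k} := [ffun i => Ordinal (gP I i)].
have gfP I : order_preserving (gf I).
  apply/order_preservingP => j i ji; rewrite !ffunE leEord /=.
  apply: leq_sub2l; apply: subset_leq_card; apply/subsetP => r; rewrite !inE.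
  move=> /(down_closedP _ (valP I)); apply.
  by apply/andP; split=> //=; exact: lexx.
pose inv I : state := exist (fun f => is_true (order_preserving f)) _ (gfP I).
have invE I i : inv I i = (k.-1 - #|col I i|)%N :> nat.
  by rewrite /state_fun /= ffunE.
exists inv => [g|I].
  apply: stateP => i; apply: val_inj; rewrite /= invE.
  have gk : (g i <= k.-1)%N by rewrite -ltnS prednK // ltn_ord.
  have colE (r : 'I_k.-1) : (r < #|col (tilde g) i|)%N = (r < k.-1 - g i)%N.
    by rewrite -memE mem_tilde tilde_arith // ltn_subRL addnC.
  suff -> : #|col (tilde g) i| = (k.-1 - g i)%N by rewrite subKn.
  apply/eqP; rewrite eqn_leq; apply/andP; split; rewrite leqNgt; apply/negP.
    move=> lt; have := colE (Ordinal (leq_trans lt (col_le _ _))).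
    by rewrite /= lt ltnn.
  move=> lt; have := colE (Ordinal (leq_trans lt (leq_subr _ _))).
  by rewrite /= lt ltnn.
apply: val_inj; apply/setP => -[i r]; rewrite mem_tilde memE tilde_arith //.
by rewrite invE -[X in (_ < X)%N](subnK (col_le I i)) addnC ltn_add2l.
Qed.

Definition q_to_ideal (R : realType) :
    polyring R state -> polyring R (order_ideals grid) :=
  psubst (fun g => var R (tilde g)).

End StateSpace.

(* Main.v *)
(**
With F_i the distribution function of Z_i, the cumulative coordinate q_g
becomes t P(X <= g) = t P(Z <= g) = t \prod_i F_i(g_i), so the binomials vanish
on the model.  Choosing F_i(l) = \prod_(r <= k - l - 2) x_(i,r) with x in the unit
cube turns these values into those of the Hibi parameterization, and a
polynomial vanishing on the unit cube is 0; hence the model ideal is contained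
in the Hibi ideal.  Finally, modulo the binomials a product of variables can be
rewritten so that its first factor is the meet of all factors, and this meet is
determined by the Hibi monomial; by induction, products with the same Hibi
monomial are congruent, so the binomials generate the Hibi ideal.
*)

Require Import Defs.
From mathcomp Require Import all_boot all_order all_algebra.
From mathcomp Require Import reals.
From mathcomp Require Import mpoly.
From mathcomp Require Import zify ring.
Set Implicit Arguments.
Unset Strict Implicit.
Unset Printing Implicit Defensive.
Import Order.TTheory GRing.Theory Num.Theory.
Local Open Scope ring_scope.

(** * Polynomials vanishing on the unit cube *)

Lemma radix_inj (N n : nat) (f g : 'I_n -> nat) :
  (forall i, f i < N)%N -> (forall i, g i < N)%N ->
  (\sum_(i < n) f i * N ^ i = \sum_(i < n) g i * N ^ i)%N -> f =1 g.
Proof.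
elim: n f g => [|n IHn] f g fN gN; first by move=> _ [].
have N_gt0 : (0 < N)%N by apply: leq_ltn_trans (fN ord0).
have split_low (u : 'I_n.+1 -> nat) : (\sum_(i < n.+1) u i * N ^ i =
    (\sum_(i < n) u (lift ord0 i) * N ^ i) * N + u ord0)%N.
  rewrite big_ord_recl expn0 muln1 addnC big_distrl /=; congr addn.
  by apply: eq_bigr => i _; rewrite expnS; lia.
rewrite !split_low => fg.
(* Reduction modulo N isolates the lowest digit, which is its own remainder because it is below
   N. *)
have fg0 : f ord0 = g ord0.
  by have := congr1 (modn^~ N) fg; rewrite /= !modnMDl !modn_small.
move/eqP: fg; rewrite fg0 eqn_add2r eqn_pmul2r // => /eqP/IHn fgS i.
by case: (unliftP ord0 i) => [j|] -> //; apply: fgS.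
Qed.

(* Kronecker's substitution x_i = s^(N^i) with N larger than the degree
   separates the monomials of p. *)
Lemma mpoly_eq0_unit_cube (R : realFieldType) (n : nat) (p : {mpoly R[n]}) :
  (forall v : 'I_n -> R, (forall i, 0 <= v i <= 1) -> p.@[v] = 0) -> p = 0.
Proof.
move=> p0; pose N := msize p.
pose w (m : 'X_{1..n}) := (\sum_(i < n) m i * N ^ i)%N.
have w_inj m m' : m \in msupp p -> m' \in msupp p -> w m = w m' -> m = m'.
  have small m1 : m1 \in msupp p -> forall i, (m1 i < N)%N.
    move=> /msize_mdeg_lt m1N i; apply: leq_ltn_trans m1N.
    by rewrite mdegE (bigD1 i) //= leq_addr.
  move=> mp m'p ww; apply/mnmP; apply: (radix_inj _ _ ww); exact: small.
pose q : {poly R} := \sum_(m <- msupp p) p@_m *: 'X^(w m).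
have q0 : q = 0.
  (* The points 1/(j+1) are distinct and all their powers stay in [0,1], so q has [size q] roots,
     too many unless it is 0. *)
  pose s := [seq (j.+1%:R : R)^-1 | j <- iota 0 (size q)].
  apply: (@roots_geq_poly_eq0 _ _ s).
  - apply/allP => _ /mapP[j _ ->]; apply/eqP.
    rewrite horner_sum; transitivity p.@[fun i => j.+1%:R^-1 ^+ (N ^ i)].
      rewrite mevalE; apply: eq_bigr => m _; rewrite hornerZ hornerXn; congr (_ * _).
      rewrite /w -prodrXr; apply: eq_bigr => i _.
      by rewrite -exprM mulnC.
    apply: p0 => i; have j1 : (1 : R) <= j.+1%:R by rewrite ler1n.
    rewrite exprn_ge0 ?exprn_ile1 ?invr_ge0 ?ler0n //.
    by rewrite invf_le1 // ltr0n.
  - rewrite map_inj_uniq ?iota_uniq // => i j /invr_inj /eqP.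
    by rewrite eqr_nat eqSS => /eqP.
  - by rewrite size_map size_iota.
apply/mpolyP => m; rewrite mcoeff0; have [mp|] := boolP (m \in msupp p); last first.
  by move/memN_msupp_eq0.
(* Since [w] is injective on the support, only m contributes to the coefficient of q at [w m]. *)
rewrite -[RHS](coef0 _ (w m)) -q0 coef_sum.
rewrite (bigD1_seq m) ?msupp_uniq //= coefZ coefXn eqxx mulr1 big_seq_cond.
rewrite big1 ?addr0 // => m' /andP[m'p m'm].
rewrite coefZ coefXn; case: eqP => [/w_inj mm'|_]; last by rewrite mulr0.
by rewrite mm' ?eqxx in m'm.
Qed.

(** * Generated ideals and kernels of monomial maps *)

Section IdealGen.
Variables (A : comNzRingType) (S : A -> Prop).
Implicit Types (f g h : A).

Lemma ideal_gen0 : ideal_gen S 0.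
Proof. by exists 0%N, (fun=> 0), (fun=> 0); split=> [[]|] //; rewrite big_ord0. Qed.

Lemma ideal_gen_incl f : S f -> ideal_gen S f.
Proof.
by exists 1%N, (fun=> 1), (fun=> f); split=> //; rewrite big_ord1 mul1r.
Qed.

Lemma ideal_genD f g : ideal_gen S f -> ideal_gen S g -> ideal_gen S (f + g).
Proof.
move=> [m [c [s [Ss ->]]]] [m' [c' [s' [Ss' ->]]]].
exists (m + m')%N, (fun i => match split i with inl j => c j | inr j => c' j end),
  (fun i => match split i with inl j => s j | inr j => s' j end); split.
  by move=> i; case: split.
rewrite big_split_ord; congr (_ + _); apply: eq_bigr => i _.
  by rewrite (unsplitK (inl i : 'I_m + 'I_m')).
by rewrite (unsplitK (inr i : 'I_m + 'I_m')).
Qed.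

Lemma ideal_genM f g : ideal_gen S g -> ideal_gen S (f * g).
Proof.
move=> [m [c [s [Ss ->]]]]; exists m, (fun i => f * c i), s; split=> //.
by rewrite mulr_sumr; apply: eq_bigr => i _; rewrite mulrA.
Qed.

Lemma ideal_gen_sum (I : eqType) (r : seq I) (F : I -> A) :
  (forall i, i \in r -> ideal_gen S (F i)) -> ideal_gen S (\sum_(i <- r) F i).
Proof.
by move=> SF; rewrite big_seq; apply: big_ind SF; [exact: ideal_gen0 | exact: ideal_genD].
Qed.

Lemma ideal_gen_refl f : ideal_gen S (f - f).
Proof. by rewrite subrr; exact: ideal_gen0. Qed.

Lemma ideal_gen_trans g f h :
  ideal_gen S (f - g) -> ideal_gen S (g - h) -> ideal_gen S (f - h).
Proof. by move=> fg /(ideal_genD fg); rewrite addrA subrK. Qed.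

Lemma ideal_gen_sym f g : ideal_gen S (f - g) -> ideal_gen S (g - f).
Proof. by move=> /(ideal_genM (- 1)); rewrite mulN1r opprB. Qed.

Lemma ideal_gen_mull h f g :
  ideal_gen S (f - g) -> ideal_gen S (h * f - h * g).
Proof. by rewrite -mulrBr; exact: ideal_genM. Qed.

End IdealGen.

(* Replacing each monomial by a chosen representative of its fibre turns F
   into the image of [phi F], with each [X^u] replaced by the representative
   over u; hence into 0. *)
Lemma monomial_ker_ideal_gen (R : comNzRingType) (n n' : nat)
    (phi : {linear {mpoly R[n]} -> {mpoly R[n']}})
    (e : 'X_{1..n} -> 'X_{1..n'}) (S : {mpoly R[n]} -> Prop) :
  (forall m, phi 'X_[m] = 'X_[e m]) ->
  (forall m m', e m = e m' -> ideal_gen S ('X_[m] - 'X_[m'])) ->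
  forall F, phi F = 0 -> ideal_gen S F.
Proof.
move=> phiX fibre F phiF; pose s := msupp F.
(* The default 0 is never reached for u in the image of the support. *)
pose rep u := nth 0%MM s (find (fun m => e m == u) s).
have e_rep m : m \in s -> e (rep (e m)) = e m.
  by move=> ms; apply/eqP/(@nth_find _ _ (fun m' => e m' == e m))/hasP; exists m.
(* Subtracting this zero sum writes F as a combination of the differences ['X_[m] - 'X_[rep (e m)]],
   each within one fibre. *)
suff /esym F0 : \sum_(m <- s) F@_m *: 'X_[rep (e m)] = 0 :> {mpoly R[n]}.
  rewrite -[F]subr0 F0 {1}[F]mpolyE -sumrB; apply: ideal_gen_sum => m ms.
  rewrite -scalerBr -mul_mpolyC; apply: ideal_genM; apply: fibre.
  by rewrite e_rep.
pose U := undup (map e s).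
transitivity (\sum_(u <- U) (phi F)@_u *: ('X_[rep u] : {mpoly R[n]})); last first.
  by apply: big1 => u _; rewrite phiF mcoeff0 scale0r.
transitivity (\sum_(u <- U) \sum_(m <- s | e m == u)
    F@_m *: ('X_[rep u] : {mpoly R[n]})); last first.
  apply: eq_bigr => u _; rewrite -scaler_suml; congr (_ *: _).
  rewrite {2}[F]mpolyE !linear_sum /= big_mkcond; apply: eq_bigr => m _.
  by rewrite !linearZ /= phiX mcoeffX; case: eqP; rewrite ?mulr1 ?mulr0.
rewrite (exchange_big_dep xpredT) //=; apply: eq_big_seq => m ms.
rewrite big_mkcond (bigD1_seq (e m)) ?undup_uniq ?mem_undup ?map_f //= eqxx.
by rewrite big1 ?addr0 // => u; rewrite eq_sym => /negbTE->.
Qed.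

(** * Evaluation and substitution *)

Section Evaluation.
Variables (R : comNzRingType) (T U : finType).
Implicit Types (v : T -> R) (s : T -> polyring R U).

Lemma peval_var v x : peval v (var R x) = v x.
Proof. by rewrite /peval mevalXU enum_rankK. Qed.

Lemma pevalM v : {morph peval v : f g / f * g}.
Proof. exact: rmorphM. Qed.

Lemma pevalB v : {morph peval v : f g / f - g}.
Proof. exact: rmorphB. Qed.

Lemma peval_sum v (I : Type) (r : seq I) (P : pred I) (F : I -> polyring R T) :
  peval v (\sum_(i <- r | P i) F i) = \sum_(i <- r | P i) peval v (F i).
Proof. exact: raddf_sum. Qed.

Lemma peval_prod v (I : Type) (r : seq I) (P : pred I) (F : I -> polyring R T) :
  peval v (\prod_(i <- r | P i) F i) = \prod_(i <- r | P i) peval v (F i).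
Proof. exact: rmorph_prod. Qed.

Lemma eq_peval v v' f : v =1 v' -> peval v f = peval v' f.
Proof. by move=> vv'; apply: meval_eq => i; rewrite vv'. Qed.

Lemma peval_psubst (v : U -> R) s f :
  peval v (psubst s f) = peval (fun x => peval v (s x)) f.
Proof.
rewrite /peval [psubst s f]comp_mpolyE rmorph_sum /= mevalE; apply: eq_bigr => m _.
rewrite mevalZ rmorph_prod /=; congr (_ * _); apply: eq_bigr => i _.
by rewrite rmorphXn /= tnth_mktuple.
Qed.

End Evaluation.

(** * Structural equations and the distribution function of X *)

Section MaxLinear.
Variables (n : nat) (D : dag n) (k : nat).
Implicit Types (g h : state D k) (z : {ffun 'I_n -> 'I_k}).

Lemma edge_lt (j i : tr D) : edge D j i -> (j < i)%O.
Proof.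
move=> ji; rewrite lt_neqAle; apply/andP; split; last exact: connect1.
apply/eqP => ij; have := @edge_acyclic n D [:: i].
by rewrite /= andbT -{1}ij ji => /(_ isT).
Qed.

Lemma tr_le_parent (j i : tr D) :
  (j <= i)%O -> j = i \/ exists2 l : tr D, edge D l i & (j <= l)%O.
Proof.
case/connectP; case/lastP => [|p l] /=; first by left.
rewrite rcons_path last_rcons => /andP[jp pl] ->.
by right; exists (last j p) => //; apply/connectP; exists p.
Qed.

(** Every edge strictly increases the number of elements strictly below a vertex, and this number
    carries the induction. *)
Lemma dag_ind (P : tr D -> Prop) :
  (forall i, (forall j : tr D, edge D j i -> P j) -> P i) -> forall i, P i.
Proof.
move=> IH i; have [m] := ubnP #|[set h : tr D | (h < i)%O]|.
elim: m i => // m IHm i im; apply: IH => j /edge_lt ji; apply: IHm.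
apply: leq_trans (im : (_ <= m)%N); apply/proper_card/properP; split.
  by apply/subsetP => x; rewrite !inE => /lt_trans; apply.
by exists j; rewrite !inE ?ltxx.
Qed.

Definition structural_solution z g : bool :=
  [forall i, (g i : nat) == maxn (parents_max g i) (z i)].

(** The solution is the least state dominating the noise: a bound on z propagates along edges. Hence
    X <= h means Z <= h, a condition that splits over the vertices. *)
Lemma structural_solution_le z g h :
  structural_solution z g -> (g <= h)%O = [forall i, (z i <= h i)%N].
Proof.
move=> /forallP zg; rewrite state_leE; apply/forallP/forallP => [gh i|zh i].
  by apply: leq_trans (gh i); rewrite (eqP (zg i)) leq_maxr.
elim/dag_ind: i => i IHi; rewrite (eqP (zg i)) geq_max zh andbT.
apply/bigmax_leqP => j ji; apply: leq_trans (IHi j ji) _.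
by apply: state_homo; apply/ltW/edge_lt.
Qed.

Lemma structural_solution_unique z g h :
  structural_solution z g -> structural_solution z h -> g = h.
Proof.
have self_le g' : structural_solution z g' -> [forall i, (z i <= g' i)%N].
  by move=> zg'; rewrite -(structural_solution_le _ zg').
move=> zg zh; apply/le_anti.
by rewrite (structural_solution_le _ zg) (structural_solution_le _ zh) !self_le.
Qed.

Lemma structural_solution_exists z : exists g, structural_solution z g.
Proof.
(* The solution at i is the largest noise among i and its ancestors; [a i] is a vertex attaining
   it. *)
pose a (i : tr D) : tr D := [arg max_(j > i | (j <= i)%O) (z j : nat)].
have aP i : (a i <= i)%O /\ forall j : tr D, (j <= i)%O -> (z j <= z (a i))%N.
  by rewrite /a; case: arg_maxnP.
have homo_a : order_preserving [ffun i => z (a i)].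
  apply/order_preservingP => j i ji; rewrite !ffunE leEord.
  by apply: (aP i).2; apply: le_trans ji; apply: (aP j).1.
pose g : state D k := exist (fun f => is_true (order_preserving f)) _ homo_a.
have gE i : g i = z (a i) by rewrite /g /state_fun /= ffunE.
exists g; apply/forallP => i; rewrite eqn_leq; apply/andP; split; last first.
  rewrite geq_max; apply/andP; split; last by rewrite gE; apply: (aP i).2.
  apply/bigmax_leqP => j /edge_lt ji; exact: (state_homo g (ltW ji)).
(* The maximum is attained at i itself, or at a vertex reaching i through a parent l and hence
   bounded by [g l]. *)
rewrite leq_max gE; case/tr_le_parent: (aP i).1 => [->|[l li al]].
  by rewrite leqnn orbT.
apply/orP; left; apply: (@leq_trans (g l)); first by rewrite gE; apply: (aP l).2.
by apply: (@leq_bigmax_cond _ _ (fun j => nat_of_ord (g j))).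
Qed.

(** Both sides become sums over noise vectors z. Each z has exactly one solution, so it is counted
    at most once on the left, and precisely when z <= g. *)
Lemma sum_psi_le (R : realType) (theta : 'I_n -> 'I_k -> R) g :
  \sum_(h : state D k | (h <= g)%O) psi theta h =
    \prod_(i < n) \sum_(l < k | (l <= g i)%N) theta i l.
Proof.
rewrite bigA_distr_big_dep /=; under eq_bigr do rewrite psiE.
rewrite (exchange_big_dep xpredT) //= [RHS]big_mkcond; apply: eq_bigr => z _.
have [h0 zh0] := structural_solution_exists z.
have -> : (z \in family (fun (i : 'I_n) (l : 'I_k) => (l <= g i)%N)) = (h0 <= g)%O.
  by rewrite (structural_solution_le _ zh0); apply/familyP/forallP.
case: ifP => h0g.
  apply: big_pred1 => h; apply/andP/eqP => [[_ zh]|->]; last exact: conj h0g zh0.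
  exact: structural_solution_unique zh zh0.
apply: big_pred0 => h; apply/negbTE/andP => -[hg zh].
by rewrite (structural_solution_unique zh0 zh) hg in h0g.
Qed.

(** * From the binomials to the model, and from the model to the Hibi ideal *)

Variable R : realType.
Implicit Types (F : polyring R (state D k)).

Lemma peval_q_to_p (t : R) (theta : 'I_n -> 'I_k -> R) F :
  peval (fun g => t * psi theta g) (q_to_p F) =
  peval (fun g => t * \prod_(i < n) \sum_(l < k | (l <= g i)%N) theta i l) F.
Proof.
rewrite /q_to_p peval_psubst; apply: eq_peval => g.
rewrite -sum_psi_le mulr_sumr /cumulative peval_sum.
by apply: eq_bigr => h _; rewrite peval_var.
Qed.

Lemma ideal_gen_model F : ideal_gen (@binomial_relation n D k R) F -> model_ideal_q F.
Proof.
move=> [m [c [s [sB ->]]]] t theta _; rewrite peval_q_to_p peval_sum.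
apply: big1 => j _; rewrite pevalM; have [g [h [_ ->]]] := sB j.
rewrite pevalB !pevalM !peval_var [X in _ * X](_ : _ = 0) ?mulr0 //.
apply/eqP; rewrite subr_eq0; apply/eqP.
(* At each vertex, minimum and maximum only permute the two values of the distribution function. *)
rewrite mulrACA [RHS]mulrACA -!big_split /=; congr (_ * _); apply: eq_bigr => i _.
rewrite state_meetE state_joinE.
by case: (leP (g i) (h i)) => // _; rewrite mulrC.
Qed.

Lemma peval_hibi_q (x : option (grid D k) -> R) F :
  peval x (hibi_map (q_to_ideal F)) =
  peval (fun g => x None * \prod_(a in val (tilde g)) x (Some a)) F.
Proof.
rewrite /hibi_map /q_to_ideal !peval_psubst; apply: eq_peval => g.
by rewrite peval_var pevalM peval_var peval_prod; under eq_bigr do rewrite peval_var.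
Qed.

Lemma model_hibi F : (0 < k)%N -> model_ideal_q F -> hibi_ideal (q_to_ideal F).
Proof.
move=> k_gt0 modF; apply: mpoly_eq0_unit_cube => v v01.
pose x (o : option (grid D k)) : R := v (enum_rank o).
(* The intended distribution function of Z_i: for l = g_i, the product of x over column i of
   [tilde g]. Its successive differences are the masses. *)
pose G (i : tr D) (l : nat) : R :=
  \prod_(r : 'I_k.-1 | (r + l + 2 <= k)%N) x (Some ((i, r) : grid D k)).
pose mass i l := if l is l'.+1 then G i l - G i l' else G i 0%N.
pose theta (i : 'I_n) (l : 'I_k) : R := mass i l.
have G0 i l : 0 <= G i l.
  by apply: prodr_ge0 => r _; have /andP[] := v01 (enum_rank (Some ((i, r) : grid D k))).
(* Raising l drops factors lying in [0,1]; this makes the masses nonnegative. *)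
have GS i l : G i l <= G i l.+1.
  rewrite /G big_mkcond [X in _ <= X]big_mkcond; apply: ler_prod => r _.
  have /andP[x0 x1] := v01 (enum_rank (Some ((i, r) : grid D k))).
  case: ifP => rl; case: ifP => rl'; rewrite ?ler01 ?lexx ?x0 //.
  lia.
have cdf i m : (m < k)%N -> \sum_(l < k | (l <= m)%N) theta i l = G i m.
  move=> mk; transitivity (\sum_(l < k | (l < m.+1)%N) mass i l) => //.
  rewrite -(big_ord_widen _ (mass i)) //.
  elim: m {mk} => [|m IHm]; first by rewrite big_ord1.
  by rewrite big_ord_recr /= IHm addrC subrK.
have thetaP i : simplex (theta i).
  split=> [l|].
    by rewrite /theta /mass; case: (nat_of_ord l) => [|l'] //; rewrite subr_ge0.
  transitivity (\sum_(l < k | (l <= k.-1)%N) theta i l).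
    by apply: eq_bigl => l; rewrite -ltnS prednK // ltn_ord.
  (* At l = k-1 the product is empty, so the total mass is 1. *)
  rewrite cdf ?ltn_predL // /G big_pred0 // => r; lia.
have -> : (hibi_map (q_to_ideal F)).@[v] = peval x (hibi_map (q_to_ideal F)).
  by apply: meval_eq => i; rewrite /x enum_valK.
rewrite -[RHS](modF (x None) theta thetaP) peval_q_to_p peval_hibi_q.
apply: eq_peval => g; congr (_ * _).
under [RHS]eq_bigr do rewrite cdf //.
rewrite pair_big_dep /=; apply: eq_big => [[i r]|[i r] //].
by rewrite mem_tilde.
Qed.

(** * Hibi monomials and straightening *)

Definition hibi_exponent g : 'X_{1..#|{: option (grid D k)}|} :=
  [multinom (if enum_val i is Some a then a \in val (tilde g) else true : nat)
    | i < #|{: option (grid D k)}|].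

Lemma hibi_q_var g : hibi_map (q_to_ideal (var R g)) = 'X_[hibi_exponent g].
Proof.
rewrite /q_to_ideal /hibi_map !psubst_var /var mprodXE -mpolyXD; congr 'X_[_].
apply/mnmP => i; rewrite mnmDE mnm_sumE [RHS]mnmE mnm1E -[i]enum_valK enum_rankK.
under eq_bigr do rewrite mnm1E (inj_eq enum_rank_inj).
rewrite (inj_eq enum_rank_inj); case: (enum_val i) => [a|]; last by rewrite big1 ?addn0.
case: (boolP (a \in _)) => aA; last first.
  by rewrite big1 // => b bA; case: eqP => // -[ba]; rewrite -ba bA in aA.
rewrite (bigD1 a) //= eqxx big1 // => b /andP[_ ba].
by case: eqP => // -[/eqP]; rewrite (negbTE ba).
Qed.

Lemma hibi_exponent_meet_join g h :
  (hibi_exponent (g `&` h)%O + hibi_exponent (g `|` h)%O =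
   hibi_exponent g + hibi_exponent h)%MM.
Proof.
apply/mnmP => i; rewrite !mnmDE !mnmE; case: (enum_val i) => [[j r]|//].
rewrite !mem_tilde state_meetE state_joinE.
by case: (leP (g j) (h j)) => // _; rewrite addnC.
Qed.

Lemma hibi_exponent_some g a :
  hibi_exponent g (enum_rank (Some a)) = (a \in val (tilde g)).
Proof. by rewrite mnmE enum_rankK. Qed.

Lemma hibi_exponent_none g : hibi_exponent g (enum_rank None) = 1%N.
Proof. by rewrite mnmE enum_rankK. Qed.

(** The bijection [tilde] reverses the order, so meets become unions. *)
Lemma mem_tilde_meet g h a :
  (a \in val (tilde (g `&` h)%O)) = (a \in val (tilde g)) || (a \in val (tilde h)).
Proof.
case: a => j r; rewrite !mem_tilde state_meetE.
by case: (leP (g j) (h j)); rewrite ?leEord ?ltEord; lia.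
Qed.

Let gens := @binomial_relation n D k R.
Let monomial (s : seq (state D k)) : polyring R (state D k) := \prod_(g <- s) var R g.
Let exponent (s : seq (state D k)) := (\sum_(g <- s) hibi_exponent g)%MM.
Let meets g (s : seq (state D k)) := foldl Order.meet g s.

Lemma straighten g h :
  ideal_gen gens (var R g * var R h - var R (g `&` h)%O * var R (g `|` h)%O).
Proof.
have [gh|] := boolP (g >=< h)%O; last first.
  by move=> gh; apply: ideal_gen_incl; exists g, h.
case/orP: gh => gh; first by rewrite (meet_l gh) (join_r gh); exact: ideal_gen_refl.
by rewrite (meet_r gh) (join_l gh) [X in _ - X]mulrC; exact: ideal_gen_refl.
Qed.

(** Going through s, the carried factor g and the next factor h are exchanged for their meet,
    carried on, and their join, left behind in s'. *)
Lemma sweep_meet g s : exists2 s',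
  ideal_gen gens (monomial (g :: s) - monomial (meets g s :: s')) &
  exponent (g :: s) = exponent (meets g s :: s').
Proof.
elim: s g => [|h s IHs] g /=; first by exists [::] => //; exact: ideal_gen_refl.
have [s' s'gen s'exp] := IHs (g `&` h)%O; exists ((g `|` h)%O :: s').
  rewrite /monomial !big_cons in s'gen *.
  rewrite mulrA; apply: ideal_gen_trans.
    by rewrite mulrC; apply: ideal_gen_mull; exact: straighten.
  rewrite [X in X - _](_ : _ = var R (g `|` h)%O *
    (var R (g `&` h)%O * \prod_(j <- s) var R j)); last by ring.
  by rewrite [X in _ - X]mulrCA; exact: ideal_gen_mull.
rewrite /exponent !big_cons in s'exp *.
apply/mnmP => i; have := congr1 (fun e : 'X_{1.._} => e i) s'exp.
have := congr1 (fun e : 'X_{1.._} => e i) (hibi_exponent_meet_join g h).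
by rewrite /= !mnmDE; lia.
Qed.

(** A union of ideals is the support of the sum of their indicators, so the exponent determines the
    meet. *)
Lemma mem_tilde_meets g s a :
  (a \in val (tilde (meets g s))) = (0 < exponent (g :: s) (enum_rank (Some a)))%N.
Proof.
elim: s g => [|h s IHs] g /=.
  by rewrite /exponent big_seq1 hibi_exponent_some; case: (_ \in _).
rewrite IHs /exponent !big_cons !mnmDE !hibi_exponent_some mem_tilde_meet.
by case: (_ \in _); case: (_ \in _).
Qed.

(** Each Hibi monomial contains t exactly once, so equal exponents force equally many factors. *)
Lemma exponent_none s : exponent s (enum_rank None) = size s.
Proof.
rewrite /exponent mnm_sumE -sum1_size.
by apply: eq_bigr => g _; exact: hibi_exponent_none.
Qed.

(* The meet of all factors is determined by the exponent, so after [sweep_meet]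
   it can be cancelled. *)
Lemma monomial_congr s s' : (0 < k)%N ->
  exponent s = exponent s' -> ideal_gen gens (monomial s - monomial s').
Proof.
move=> k_gt0; have [m] := ubnP (size s).
elim: m s s' => // m IHm s s' sm ss'.
have := congr1 (fun e : 'X_{1.._} => e (enum_rank None)) ss'.
rewrite /= !exponent_none.
case: s s' => [|g s] [|g' s'] //= in sm ss' *; first by move=> _; exact: ideal_gen_refl.
move=> _.
have meet_eq : meets g s = meets g' s'.
  apply: (bij_inj (@tilde_bij n D k k_gt0)); apply/val_inj/setP => a.
  by rewrite !mem_tilde_meets ss'.
have [u ugen uexp] := sweep_meet g s; have [u' ugen' uexp'] := sweep_meet g' s'.
apply: ideal_gen_trans ugen _; apply: ideal_gen_sym; apply: ideal_gen_trans ugen' _.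
apply: ideal_gen_sym.
have su : size u = size s.
  have := congr1 (fun e : 'X_{1.._} => e (enum_rank None)) uexp.
  by rewrite /= !exponent_none => -[].
rewrite meet_eq in uexp *; rewrite /monomial !big_cons; apply: ideal_gen_mull.
apply: IHm; first by rewrite su.
apply: (@addmI _ (hibi_exponent (meets g' s'))).
by move: uexp'; rewrite -ss' uexp /exponent !big_cons.
Qed.

Lemma hibi_ideal_gen F : (0 < k)%N -> hibi_ideal (q_to_ideal F) -> ideal_gen gens F.
Proof.
move=> k_gt0.
pose factors (m : 'X_{1..#|{: state D k}|}) :=
  flatten [seq nseq (m i) (enum_val i) | i <- enum 'I_#|{: state D k}|].
have factorsK m : 'X_[m] = monomial (factors m).
  rewrite mpolyXE_id /monomial big_flatten big_map big_enum; apply: eq_bigr => i _.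
  by rewrite big_nseq iter_mulr_1 /var enum_valK.
(* This is [hibi_map] after [q_to_ideal], recast as a bundled morphism. *)
pose phi : {lrmorphism polyring R (state D k) -> polyring R (option (grid D k))} :=
  comp_mpoly [tuple var R None * \prod_(a in val (enum_val i)) var R (Some a)
             | i < #|{: order_ideals (grid D k)}|] \o
  comp_mpoly [tuple var R (tilde (enum_val i)) | i < #|{: state D k}|].
apply: (monomial_ker_ideal_gen (phi := phi) (e := exponent \o factors)) => [m|m m' mm'].
  rewrite factorsK /monomial rmorph_prod /exponent /= -mprodXE.
  by apply: eq_bigr => g _; exact: hibi_q_var.
by rewrite !factorsK; exact: monomial_congr.
Qed.

End MaxLinear.

Theorem theorem4p3 (R : realType) (n : nat) (D : dag n) (k : nat)
    (k_gt0 : (0 < k)%N) :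
  (forall F : polyring R (state D k),
     model_ideal_q F <-> hibi_ideal (q_to_ideal F)) /\
  (forall F : polyring R (state D k),
     model_ideal_q F <-> ideal_gen (@binomial_relation n D k R) F).
Proof.
split=> F; split.
- exact: model_hibi.
- by move=> /(hibi_ideal_gen k_gt0); exact: ideal_gen_model.
- by move=> /(model_hibi k_gt0); exact: hibi_ideal_gen.
- exact: ideal_gen_model.
Qed.
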